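(* Let $\mathcal{A}:\mathbb{M}_{n_1,n_2}\to\mathbb{F}^m$ be linear with $\|\mathcal{A}\|<1$, let $K\ge1$ be an integer with $\delta_{2K}^-<1/2$, and suppose that $b=\mathcal{A}X_0+\epsilon$, where $X_0\in\mathbb{M}_{n_1,n_2}$ has $\mathrm{rank}(X_0)=K$ and $\epsilon\in\mathbb{F}^m$. Assume that $$\sigma_K(X_0)>\left(\frac{5}{(1-2\delta_{2K}^-)^{3/2}}\right)\|\epsilon\| .$$ Then the best rank $K$ solution $X_B$, i.e. the unique solution of $\operatorname{arg\,min}_{\mathrm{rank}(X)\le K}\|\mathcal{A}X-b\|$, is the unique global minimizer of $$\mathcal{R}_{K,reg}(X)=\mathcal{Q}_2(\iota_{R_K})(X)+\|\mathcal{A}X-b\|^2,\qquad X\in\mathbb{M}_{n_1,n_2},$$ and $\mathcal{R}_{K,reg}$ has no other local minimizers. Moreover $$\|X_B-X_0\|\le \frac{2\|\epsilon\|}{\sqrt{1-\delta_{2K}^-}} .$$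
   Context: $\mathbb{F}$ is $\mathbb{R}$ or $\mathbb{C}$, and $\mathbb{M}_{n_1,n_2}$ is the space of $n_1\times n_2$ matrices with entries in $\mathbb{F}$. Norms of matrices are Frobenius norms, norms of vectors are $\ell^2$-norms, and $\|\mathcal{A}\|$ is the corresponding operator norm. $\sigma_1(X)\ge\dots\ge\sigma_n(X)\ge 0$, $n=\min(n_1,n_2)$, are the singular values of $X$. $R_K=\{X\in\mathbb{M}_{n_1,n_2}:\mathrm{rank}(X)\le K\}$, and $\iota_{R_K}(X)=0$ if $X\in R_K$, $\iota_{R_K}(X)=\infty$ otherwise. For a functional $F$ on an inner product space $\mathcal{V}$, the quadratic envelope is $\mathcal{Q}_2(F)=\mathcal{S}_2(\mathcal{S}_2(F))$, where $\mathcal{S}_2(F)(Y)=\sup_{X\in\mathcal{V}}\big(-F(X)-\|X-Y\|^2\big)$; equivalently, for lower semicontinuous $[0,\infty]$-valued $F$, $\mathcal{Q}_2(F)(X)+\|X\|^2$ is the lower semicontinuous convex envelope of $F(X)+\|X\|^2$. The lower restricted isometry constant $\delta_{J}^-$ of $\mathcal{A}$ is defined, for an integer $J\ge1$, by $$1-\delta_J^-=\inf\left\{\frac{\|\mathcal{A}X\|^2}{\|X\|^2}: X\in\mathbb{M}_{n_1,n_2},\ X\ne 0,\ \mathrm{rank}(X)\le J\right\}.$$ *)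

(* Defs.v *)
From HB Require Import structures.
From mathcomp Require Import all_boot all_order all_algebra.
From mathcomp Require Import complex.
From mathcomp Require Import all_classical all_reals all_analysis.

Set Implicit Arguments.
Unset Strict Implicit.
Unset Printing Implicit Defensive.

Import Order.TTheory GRing.Theory Num.Theory.

Local Open Scope classical_set_scope.
Local Open Scope ring_scope.
Local Open Scope complex_scope.
Local Open Scope sesquilinear_scope.

Inductive field_kind := RealScalars | ComplexScalars.

Definition base_field (k : field_kind) (R : realType) : numFieldType :=
  match k with RealScalars => R | ComplexScalars => R[i] end.

Definition to_complex (k : field_kind) (R : realType) : base_field k R -> R[i] :=
  match k return base_field k R -> R[i] with
  | RealScalars => fun x => x%:C
  | ComplexScalars => fun z => z
  end.

(* The modulus as an element of R: the library norm of R[i] takes values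
   in R[i]. *)
Definition modulus (k : field_kind) (R : realType) : base_field k R -> R :=
  match k return base_field k R -> R with
  | RealScalars => fun x => `|x|
  | ComplexScalars => fun z => Normc.normc z
  end.

(* Frobenius norm; on column vectors it is the l^2-norm. The library norm on
   matrices is the sup norm. *)
Definition fnorm (k : field_kind) (R : realType) (p q : nat)
    (X : 'M[base_field k R]_(p, q)) : R :=
  Num.sqrt (\sum_i \sum_j modulus (X i j) ^+ 2).

(* The square roots of the eigenvalues of X^* X, in decreasing order and with
   multiplicity. The spectral decomposition is taken over R[i], which does not
   change the eigenvalues for real X. X^* X has n2 eigenvalues, and only the
   first min(n1, n2) are kept. *)
Definition singular_values (k : field_kind) (R : realType) (n1 n2 : nat)
    (X : 'M[base_field k R]_(n1, n2)) : seq R :=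
  let XC := map_mx (@to_complex k R) X in
  let lambda := spectral_diag (XC ^t* *m XC) in
  take (minn n1 n2)
    (sort (>=%R) [seq Num.sqrt (complex.Re (lambda 0 j)) | j : 'I_n2]).

(* Singular values are indexed from 1. *)
Definition sigma (k : field_kind) (R : realType) (n1 n2 : nat) (j : nat)
    (X : 'M[base_field k R]_(n1, n2)) : R :=
  nth 0 (singular_values X) j.-1.

Definition opnorm (k : field_kind) (R : realType) (n1 n2 m : nat)
    (A : {linear 'M[base_field k R]_(n1, n2) -> 'cV[base_field k R]_m}) : \bar R :=
  ereal_sup [set (fnorm (A X))%:E | X in [set X | fnorm X <= 1]].

Definition delta_lower (k : field_kind) (R : realType) (n1 n2 m : nat)
    (A : {linear 'M[base_field k R]_(n1, n2) -> 'cV[base_field k R]_m})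
    (J : nat) : R :=
  1 - inf [set fnorm (A X) ^+ 2 / fnorm X ^+ 2 |
           X in [set X | X != 0 /\ (\rank X <= J)%N]].

Definition rank_le (k : field_kind) (R : realType) (n1 n2 K : nat)
    : set 'M[base_field k R]_(n1, n2) :=
  [set X | (\rank X <= K)%N].

Definition iota_set (T : Type) (R : realType) (S : set T) (X : T) : \bar R :=
  (if X \in S then 0 else +oo)%E.

Definition S2 (k : field_kind) (R : realType) (n1 n2 : nat)
    (F : 'M[base_field k R]_(n1, n2) -> \bar R) (Y : 'M[base_field k R]_(n1, n2))
    : \bar R :=
  ereal_sup (range (fun X => - F X - (fnorm (X - Y) ^+ 2)%:E))%E.

Definition Q2 (k : field_kind) (R : realType) (n1 n2 : nat)
    (F : 'M[base_field k R]_(n1, n2) -> \bar R)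
    : 'M[base_field k R]_(n1, n2) -> \bar R :=
  S2 (S2 F).

Definition Rreg (k : field_kind) (R : realType) (n1 n2 m : nat)
    (A : {linear 'M[base_field k R]_(n1, n2) -> 'cV[base_field k R]_m})
    (b : 'cV[base_field k R]_m) (K : nat) (X : 'M[base_field k R]_(n1, n2))
    : \bar R :=
  (Q2 (iota_set R (@rank_le k R n1 n2 K)) X + (fnorm (A X - b) ^+ 2)%:E)%E.

Definition argmin (T : Type) (d : Order.disp_t) (U : porderType d)
    (S : set T) (f : T -> U) : set T :=
  [set x | S x /\ forall y, S y -> (f x <= f y)%O].

Definition local_minimizers (k : field_kind) (R : realType) (n1 n2 : nat)
    (f : 'M[base_field k R]_(n1, n2) -> \bar R) : set 'M[base_field k R]_(n1, n2) :=
  [set X | exists2 r : R, 0 < r &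
             forall Y, fnorm (Y - X) < r -> (f X <= f Y)%E].

(* Main.v *)
Require Import Defs.
From HB Require Import structures.
From mathcomp Require Import all_boot all_order all_algebra.
From mathcomp Require Import complex.
From mathcomp Require Import all_classical all_reals all_analysis.
From mathcomp Require Import ring lra.

Set Implicit Arguments.
Unset Strict Implicit.
Unset Printing Implicit Defensive.

Import Order.TTheory GRing.Theory Num.Theory.
Import numFieldNormedType.Exports.

Local Open Scope classical_set_scope.
Local Open Scope ring_scope.

(* Let r = b - A X, let A^* r be the gradient of the data term, and call X in R_K
   stationary if X is a best rank K approximation of X + A^* r.

   Since |A| < 1, a local minimizer X of Rreg is stationary: for a best rank K
   approximation W of X + A^* r, the convexity of Q_2(iota) + |.|^2 bounds Rreg on
   the segment [X, W] by a strictly concave quadratic with slope <= 0 at X, so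
   W = X. The same choice of W in the supremum defining Q_2 gives
   Rreg(X) >= |A W - b|^2 + |W - X|^2 - |A (W - X)|^2, so global minimizers of
   Rreg are those of |A X - b| on R_K.

   Let X_B be a minimizer of |A X - b| on R_K and E_B = A^*(b - A X_B). Then
   |E_B| <= |eps|, X_B^* E_B = 0, E_B X_B^* = 0, and X_B is at distance at least
   sigma_K(X_0) - 3 |eps| from the matrices of rank < K. By an Eckart-Young
   argument X_B is therefore still a best rank K approximation of
   X_B + kappa E_B, with kappa = 5 / (4 (1 - 2 delta)); this says
   2 <W, E_B> <= |W - X_B|^2 / kappa for W in R_K. Testing the stationarity of X
   with X_B and adding the two inequalities gives
   |A (X - X_B)|^2 < (1 - delta) |X - X_B|^2 unless X = X_B. *)

(** * The real Frobenius inner product over either scalar field *)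

Section FrobeniusInnerProduct.
Variables (k : field_kind) (R : realType).
Local Notation F := (base_field k R).

Lemma to_complex_is_additive : additive (@to_complex k R).
Proof. by case: k => //= x y; rewrite rmorphB. Qed.

Lemma to_complex_is_multiplicative : multiplicative (@to_complex k R).
Proof. by case: k => //=; split=> [x y|] //; rewrite rmorphM. Qed.

HB.instance Definition _ :=
  GRing.isAdditive.Build F R[i] (@to_complex k R) to_complex_is_additive.
HB.instance Definition _ :=
  GRing.isMultiplicative.Build F R[i] (@to_complex k R)
    to_complex_is_multiplicative.

Definition re (x : F) : R := complex.Re (to_complex x).
Definition im (x : F) : R := complex.Im (to_complex x).

(** For real scalars the second coordinate is dropped, so coordinates 0 and 1 give the imaginary
    unit over the complex field and 0 over the real one. *)
Definition of_coords : R -> R -> F :=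
  match k return R -> R -> base_field k R with
  | RealScalars => fun a _ => a
  | ComplexScalars => fun a b => Complex a b
  end.

Definition conjF : F -> F :=
  match k return base_field k R -> base_field k R with
  | RealScalars => id
  | ComplexScalars => @conjc R
  end.

Lemma to_complex_conj x : to_complex (conjF x) = conjc (to_complex x).
Proof.
move: x; rewrite /conjF; case: k => x //=.
by rewrite oppr0 complexr0.
Qed.

Definition emb (t : R) : F := of_coords t 0.

Lemma to_complex_emb t : to_complex (emb t) = Complex t 0.
Proof. by rewrite /emb /of_coords; case: k. Qed.

Lemma reD x y : re (x + y) = re x + re y.
Proof. by rewrite /re rmorphD /=; case: (to_complex x) => ? ?; case: (to_complex y). Qed.

Lemma imD x y : im (x + y) = im x + im y.
Proof. by rewrite /im rmorphD /=; case: (to_complex x) => ? ?; case: (to_complex y). Qed.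

Lemma reN x : re (- x) = - re x.
Proof. by rewrite /re rmorphN /=; case: (to_complex x). Qed.

Lemma imN x : im (- x) = - im x.
Proof. by rewrite /im rmorphN /=; case: (to_complex x). Qed.

Lemma reM x y : re (x * y) = re x * re y - im x * im y.
Proof. by rewrite /re /im rmorphM /=; case: (to_complex x) => ? ?; case: (to_complex y). Qed.

Lemma imM x y : im (x * y) = re x * im y + im x * re y.
Proof. by rewrite /re /im rmorphM /=; case: (to_complex x) => ? ?; case: (to_complex y). Qed.

Lemma re_emb t : re (emb t) = t. Proof. by rewrite /re to_complex_emb. Qed.
Lemma im_emb t : im (emb t) = 0. Proof. by rewrite /im to_complex_emb. Qed.

Lemma re_of_coords a c : re (of_coords a c) = a.
Proof. by rewrite /re /of_coords; case: k. Qed.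

Lemma coords_inj x y : re x = re y -> im x = im y -> x = y.
Proof.
move: x y; rewrite /re /im; case: k => //= [[a c] [a' c']] /= -> -> //.
Qed.

Lemma of_coordsK x : of_coords (re x) (im x) = x.
Proof. by move: x; rewrite /re /im /of_coords; case: k => //= -[]. Qed.

Lemma modulus_sqr (x : F) : modulus x ^+ 2 = re x ^+ 2 + im x ^+ 2.
Proof.
move: x; rewrite /re /im; case: k => /= x.
  by rewrite real_normK ?num_real// expr0n addr0.
by case: x => a c /=; rewrite sqr_sqrtr ?addr_ge0 ?sqr_ge0.
Qed.

Lemma modulus_ge0 (x : F) : 0 <= modulus x.
Proof. by move: x; case: k => /= x //; case: x => a c; exact: sqrtr_ge0. Qed.

Lemma modulusM (x y : F) : modulus (x * y) = modulus x * modulus y.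
Proof. by move: x y; case: k => /= x y; [exact: normrM | exact: Normc.normcM]. Qed.

Lemma le_modulusD (x y : F) : modulus (x + y) <= modulus x + modulus y.
Proof. by move: x y; case: k => /= x y; [exact: ler_normD | exact: le_normcD]. Qed.

Lemma modulus0 : modulus (0 : F) = 0.
Proof. by case: k => /=; [exact: normr0 | exact: Normc.normc0]. Qed.

(** The real part of the trace of X Y^*: over both fields a real inner product whose norm is
    [fnorm]. *)
Definition dot p q (X Y : 'M[F]_(p, q)) : R :=
  \sum_i \sum_j (re (X i j) * re (Y i j) + im (X i j) * im (Y i j)).

Section Space.
Variables p q : nat.
Implicit Types (X Y Z : 'M[F]_(p, q)) (t : R).

Lemma dotC X Y : dot X Y = dot Y X.
Proof.
by apply: eq_bigr => i _; apply: eq_bigr => j _; rewrite mulrC [im _ * _]mulrC.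
Qed.

Lemma dotDl X Y Z : dot (X + Y) Z = dot X Z + dot Y Z.
Proof.
rewrite -big_split; apply: eq_bigr => i _; rewrite -big_split.
by apply: eq_bigr => j _; rewrite /= mxE reD imD; ring.
Qed.

Lemma dotNl X Z : dot (- X) Z = - dot X Z.
Proof.
rewrite -sumrN; apply: eq_bigr => i _; rewrite -sumrN.
by apply: eq_bigr => j _; rewrite /= mxE reN imN; ring.
Qed.

Lemma dotZl t X Z : dot (emb t *: X) Z = t * dot X Z.
Proof.
rewrite mulr_sumr; apply: eq_bigr => i _; rewrite mulr_sumr.
by apply: eq_bigr => j _; rewrite /= mxE reM imM re_emb im_emb; ring.
Qed.

Lemma dotDr X Y Z : dot Z (X + Y) = dot Z X + dot Z Y.
Proof. by rewrite !(dotC Z) dotDl. Qed.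
Lemma dotNr X Z : dot Z (- X) = - dot Z X.
Proof. by rewrite !(dotC Z) dotNl. Qed.
Lemma dotZr t X Z : dot Z (emb t *: X) = t * dot Z X.
Proof. by rewrite !(dotC Z) dotZl. Qed.
Lemma dot0l Z : dot 0 Z = 0.
Proof. by rewrite -[0](subrr 0) dotDl dotNl subrr. Qed.
Lemma dot0r Z : dot Z 0 = 0.
Proof. by rewrite dotC dot0l. Qed.

Definition dotE := (dotDl, dotDr, dotNl, dotNr, dotZl, dotZr).

Lemma dot_ge0 X : 0 <= dot X X.
Proof.
by apply: sumr_ge0 => i _; apply: sumr_ge0 => j _; rewrite -!expr2 addr_ge0 ?sqr_ge0.
Qed.

Lemma fnorm_sqr X : fnorm X ^+ 2 = dot X X.
Proof.
have sumE : \sum_i \sum_j modulus (X i j) ^+ 2 = dot X X.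
  by apply: eq_bigr => i _; apply: eq_bigr => j _; rewrite modulus_sqr !expr2.
by rewrite /fnorm sumE sqr_sqrtr ?dot_ge0.
Qed.

Lemma fnorm_ge0 X : 0 <= fnorm X. Proof. exact: sqrtr_ge0. Qed.

Lemma dot_eq0 X : dot X X = 0 -> X = 0.
Proof.
move=> /eqP; rewrite psumr_eq0 => [/allP h|i _]; last first.
  by apply: sumr_ge0 => j _; rewrite -!expr2 addr_ge0 ?sqr_ge0.
apply/matrixP => i j; rewrite mxE.
have := h i (mem_index_enum _).
rewrite psumr_eq0 => [/allP /(_ j (mem_index_enum _))|j' _]; last first.
  by rewrite -!expr2 addr_ge0 ?sqr_ge0.
rewrite -!expr2 paddr_eq0 ?sqr_ge0// !sqrf_eq0 => /andP[/eqP r0 /eqP i0].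
by apply: coords_inj; rewrite ?r0 ?i0 /re /im rmorph0.
Qed.

Lemma fnorm_eq0 X : fnorm X = 0 -> X = 0.
Proof. by move=> X0; apply: dot_eq0; rewrite -fnorm_sqr X0 expr0n. Qed.

Lemma fnorm0 : fnorm (0 : 'M[F]_(p, q)) = 0.
Proof. by apply/eqP; rewrite -sqrf_eq0 fnorm_sqr dot0l. Qed.

Lemma fnormN X : fnorm (- X) = fnorm X.
Proof.
by apply/eqP; rewrite -(eqrXn2 (n := 2)) ?fnorm_ge0// !fnorm_sqr !dotE opprK.
Qed.

Lemma fnormB X Y : fnorm (X - Y) = fnorm (Y - X).
Proof. by rewrite -fnormN opprB. Qed.

Lemma fnormZ t X : fnorm (emb t *: X) = `|t| * fnorm X.
Proof.
apply/eqP; rewrite -(eqrXn2 (n := 2)) ?mulr_ge0 ?fnorm_ge0//.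
by rewrite exprMn real_normK ?num_real// !fnorm_sqr !dotE mulrA expr2.
Qed.

Lemma dot_le_fnorm X Y : dot X Y <= fnorm X * fnorm Y.
Proof.
have [Y0|Ypos] := eqVneq (fnorm Y) 0.
  by rewrite (fnorm_eq0 Y0) dot0r fnorm0 mulr0.
have {Ypos} Ypos : 0 < fnorm Y by rewrite lt_def Ypos fnorm_ge0.
(* Expanding | |Y| X - |X| Y |^2 >= 0 and dividing by 2 |X| |Y| gives the claim. *)
have := dot_ge0 (emb (fnorm Y) *: X - emb (fnorm X) *: Y).
have hX := fnorm_sqr X; have hY := fnorm_sqr Y.
rewrite !dotE -hX -hY (dotC Y X) => h.
have [X0|Xpos] := eqVneq (fnorm X) 0.
  by rewrite (fnorm_eq0 X0) dot0l fnorm0 mul0r.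
have {Xpos} Xpos : 0 < fnorm X by rewrite lt_def Xpos fnorm_ge0.
rewrite -subr_ge0 -(pmulr_rge0 _ (mulr_gt0 Xpos Ypos)).
by rewrite -(pmulr_rge0 _ (ltr0n _ 2)); move: h; congr (0 <= _); ring.
Qed.

Lemma fnormD X Y : fnorm (X + Y) <= fnorm X + fnorm Y.
Proof.
rewrite -(ler_pXn2r (n := 2)) ?nnegrE ?addr_ge0 ?fnorm_ge0//.
rewrite sqrrD !fnorm_sqr !dotE (dotC Y X).
by have := dot_le_fnorm X Y; lra.
Qed.

Lemma fnorm_triangle Y X Z : fnorm (X - Z) <= fnorm (X - Y) + fnorm (Y - Z).
Proof. by rewrite -[X - Z](subrKA Y) fnormD. Qed.

Lemma fnorm_subr_sqr X Y :
  fnorm (X - Y) ^+ 2 = fnorm X ^+ 2 - 2 * dot X Y + fnorm Y ^+ 2.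
Proof. by rewrite !fnorm_sqr !dotE (dotC Y X); ring. Qed.

Lemma fnorm_addr_sqr X Y :
  fnorm (X + Y) ^+ 2 = fnorm X ^+ 2 + 2 * dot X Y + fnorm Y ^+ 2.
Proof. by rewrite !fnorm_sqr !dotE (dotC Y X); ring. Qed.

End Space.

Lemma modulus_sum (I : finType) (f : I -> F) :
  modulus (\sum_i f i) <= \sum_i modulus (f i).
Proof.
elim/big_ind2 : _ => // [|x1 x2 y1 y2 h1 h2]; first by rewrite modulus0.
by apply: (le_trans (le_modulusD _ _)); exact: lerD.
Qed.

End FrobeniusInnerProduct.

(** * Submultiplicativity, adjoints and complexification *)

Section MatrixFrobenius.
Variables (k : field_kind) (R : realType).
Local Notation F := (base_field k R).

Lemma sum_Cauchy_Schwarz n (a c : 'I_n -> R) :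
  (\sum_j a j * c j) ^+ 2 <= (\sum_j a j ^+ 2) * (\sum_j c j ^+ 2).
Proof.
pose row_of (f : 'I_n -> R) : 'M[base_field RealScalars R]_(1, n) := \row_j f j.
have dotE f g : dot (row_of f) (row_of g) = \sum_j f j * g j.
  rewrite /dot big_ord1; apply: eq_bigr => j _.
  by rewrite !mxE /re /im /= mulr0 addr0.
have sqrE f : fnorm (row_of f) ^+ 2 = \sum_j f j ^+ 2.
  by rewrite fnorm_sqr dotE; apply: eq_bigr => j _; rewrite expr2.
rewrite -!sqrE -dotE -exprMn -real_normK ?num_real//.
rewrite ler_pXn2r ?nnegrE ?mulr_ge0 ?fnorm_ge0// ler_norml dot_le_fnorm andbT.
by rewrite lerNl -dotNl (le_trans (dot_le_fnorm _ _))// fnormN.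
Qed.

Lemma fnorm_sqrE p q (X : 'M[F]_(p, q)) :
  fnorm X ^+ 2 = \sum_i \sum_j modulus (X i j) ^+ 2.
Proof.
by rewrite /fnorm sqr_sqrtr// sumr_ge0// => i _; rewrite sumr_ge0// => j _; rewrite sqr_ge0.
Qed.

Lemma fnormM p q s (X : 'M[F]_(p, q)) (Y : 'M[F]_(q, s)) :
  fnorm (X *m Y) <= fnorm X * fnorm Y.
Proof.
rewrite -(ler_pXn2r (n := 2)) ?nnegrE ?mulr_ge0 ?fnorm_ge0// exprMn !fnorm_sqrE.
rewrite [X in _ * X]exchange_big mulr_suml; apply: ler_sum => i _ /=.
rewrite mulr_sumr; apply: ler_sum => l _.
apply: le_trans (sum_Cauchy_Schwarz _ _).
rewrite ler_pXn2r ?nnegrE ?modulus_ge0 ?sumr_ge0// => [|j _]; last first.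
  by rewrite mulr_ge0 ?modulus_ge0.
rewrite mxE (le_trans (modulus_sum _))//.
by apply: ler_sum => j _; rewrite modulusM.
Qed.

Lemma fnorm_cols p q (X : 'M[F]_(p, q)) :
  fnorm X ^+ 2 = \sum_j fnorm (col j X) ^+ 2.
Proof.
rewrite fnorm_sqrE exchange_big; apply: eq_bigr => j _ /=.
by rewrite fnorm_sqrE; apply: eq_bigr => i _; rewrite big_ord1 mxE.
Qed.

Lemma dot_suml (I : finType) p q (f : I -> 'M[F]_(p, q)) Z :
  dot (\sum_i f i) Z = \sum_i dot (f i) Z.
Proof.
by elim/big_ind2 : _ => // [|x1 x2 y1 y2 <- <-]; rewrite ?dot0l ?dotDl.
Qed.

Lemma emb_of_coords (x : F) :
  x = emb k (re x) + emb k (im x) * of_coords k 0 1.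
Proof.
apply: coords_inj; rewrite ?(reD, reM, imD, imM) !re_emb !im_emb re_of_coords.
  by ring.
by move: x; rewrite /im; case: k => /= x; ring.
Qed.

Lemma re_im_of_coords (x : F) a c :
  re x * re (of_coords k a c) + im x * im (of_coords k a c) = re x * a + im x * c.
Proof.
by rewrite re_of_coords; move: x; rewrite /im; case: k => //= x; rewrite !mul0r.
Qed.

Lemma dot_scale p q (x : F) (M Z : 'M[F]_(p, q)) :
  dot (x *: M) Z = re x * dot M Z + im x * dot (of_coords k 0 1 *: M) Z.
Proof. by rewrite {1}[x]emb_of_coords scalerDl -scalerA !dotE. Qed.

(** [dot] sees real and imaginary parts separately, so each entry of E takes its real part from A at
    a matrix unit and its imaginary part from i times that image. *)
Lemma adjoint_exists n1 n2 m p
    (A : {linear 'M[F]_(n1, n2) -> 'M[F]_(m, p)}) (r : 'M[F]_(m, p)) :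
  exists E, forall X, dot X E = dot (A X) r.
Proof.
exists (\matrix_(i, j) of_coords k (dot (A (delta_mx i j)) r)
  (dot (of_coords k 0 1 *: A (delta_mx i j)) r)) => X.
rewrite {2}[X]matrix_sum_delta linear_sum dot_suml; apply: eq_bigr => i _.
rewrite linear_sum dot_suml; apply: eq_bigr => j _.
by rewrite linearZ dot_scale mxE re_im_of_coords.
Qed.

Definition complexify p q (X : 'M[F]_(p, q)) :
  'M[base_field ComplexScalars R]_(p, q) := map_mx (@to_complex k R) X.

Lemma dot_complexify p q (X Y : 'M[F]_(p, q)) :
  dot (complexify X) (complexify Y) = dot X Y.
Proof. by apply: eq_bigr => i _; apply: eq_bigr => j _; rewrite !mxE. Qed.

Lemma fnorm_complexify p q (X : 'M[F]_(p, q)) : fnorm (complexify X) = fnorm X.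
Proof.
by apply/eqP; rewrite -(eqrXn2 (n := 2)) ?fnorm_ge0// !fnorm_sqr dot_complexify.
Qed.

Lemma rank_complexify p q (X : 'M[F]_(p, q)) : \rank (complexify X) = \rank X.
Proof. exact: (mxrank_map (@to_complex k R : {rmorphism F -> R[i]})). Qed.

Lemma complexifyB p q (X Y : 'M[F]_(p, q)) :
  complexify (X - Y) = complexify X - complexify Y.
Proof. exact: (map_mxB (@to_complex k R : {rmorphism F -> R[i]})). Qed.

Lemma complexifyM p q s (X : 'M[F]_(p, q)) (Y : 'M[F]_(q, s)) :
  complexify (X *m Y) = complexify X *m complexify Y.
Proof. exact: (map_mxM (@to_complex k R : {rmorphism F -> R[i]})). Qed.

Lemma rank_scale_le p q (a : F) (X : 'M[F]_(p, q)) : (\rank (a *: X) <= \rank X)%N.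
Proof. by rewrite -mul_scalar_mx mxrankM_maxr. Qed.

End MatrixFrobenius.

(** * Orthogonal projections of complex matrices and an Eckart-Young inequality *)

Section ComplexMatrices.
Variable R : realType.
Local Notation C := (R[i]%C).
Local Open Scope sesquilinear_scope.
Local Notation cnorm X := (@fnorm ComplexScalars R _ _ X).
Local Notation cdot X Y := (@dot ComplexScalars R _ _ X Y).

Lemma cdotE p q (X Y : 'M[C]_(p, q)) : cdot X Y = complex.Re (\tr (X *m Y^t*)).
Proof.
rewrite /mxtrace raddf_sum /dot; apply: eq_bigr => i _.
rewrite mxE raddf_sum; apply: eq_bigr => j _; rewrite !mxE /re /im /=.
by case: (X i j) (Y i j) => a b [c d] /=; ring.
Qed.

Lemma cnorm_sqrE p q (X : 'M[C]_(p, q)) :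
  cnorm X ^+ 2 = complex.Re (\tr (X *m X^t*)).
Proof. by rewrite fnorm_sqr cdotE. Qed.

Lemma cnormZ p q (t : R) (M : 'M[C]_(p, q)) : cnorm (t%:C%C *: M) = `|t| * cnorm M.
Proof. exact: (@fnormZ ComplexScalars). Qed.

Lemma cdotMl p q s (X : 'M[C]_(p, q)) (M : 'M[C]_(q, s)) (Y : 'M[C]_(p, s)) :
  cdot (X *m M) Y = cdot M (X^t* *m Y).
Proof.
rewrite !cdotE trmx_mul map_mxM trmxCK mulmxA [in RHS]mxtrace_mulC.
by rewrite mulmxA.
Qed.

Lemma cdotMr p q s (M : 'M[C]_(p, q)) (X : 'M[C]_(q, s)) (Y : 'M[C]_(p, s)) :
  cdot (M *m X) Y = cdot M (Y *m X^t*).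
Proof. by rewrite !cdotE trmx_mul map_mxM trmxCK !mulmxA. Qed.

Lemma cnorm_trmxC p q (X : 'M[C]_(p, q)) : cnorm (X^t*) = cnorm X.
Proof.
apply/eqP; rewrite -(eqrXn2 (n := 2)) ?fnorm_ge0// !cnorm_sqrE trmxCK.
by rewrite mxtrace_mulC.
Qed.

Lemma cnorm_unitary p q (U : 'M[C]_(p, q)) : U \is unitarymx -> cnorm U ^+ 2 = p%:R.
Proof.
by move=> /unitarymxP UU; rewrite cnorm_sqrE UU mxtrace1 raddfMn.
Qed.

Lemma cnorm_mul_unitary p q s (M : 'M[C]_(p, q)) (U : 'M[C]_(q, s)) :
  U \is unitarymx -> cnorm (M *m U) = cnorm M.
Proof.
move=> UU; apply/eqP; rewrite -(eqrXn2 (n := 2)) ?fnorm_ge0// !cnorm_sqrE.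
by rewrite trmx_mul map_mxM mulmxA mulmxtVK.
Qed.

(** U^* U is the orthogonal projection onto the row space of U, so M splits into two orthogonal
    parts, and M U^* has the norm of the second. *)
Lemma cnorm_Pythagoras p q s (M : 'M[C]_(p, q)) (U : 'M[C]_(s, q)) :
  U \is unitarymx ->
  cnorm M ^+ 2 = cnorm (M *m (1%:M - U^t* *m U)) ^+ 2 + cnorm (M *m U^t*) ^+ 2.
Proof.
move=> UU; rewrite mulmxBr mulmx1 mulmxA.
rewrite -[cnorm (M *m U^t*)](cnorm_mul_unitary _ UU).
set N := _ *m U; rewrite -[in LHS](subrK N M) fnorm_addr_sqr.
suff -> : cdot (M - N) N = 0 by rewrite mulr0 addr0.
by rewrite dotC cdotMr mulmxBl mulmxtVK// subrr dot0r.
Qed.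

Lemma schmidt_basis p n (X : 'M[C]_(p, n)) :
  exists2 V : 'M[C]_(\rank X, n), V \is unitarymx & (V :=: X)%MS.
Proof.
exists (schmidt (row_base X)); first by rewrite schmidt_unitarymx ?rank_leq_col.
apply: (@eqmx_trans _ _ _ _ _ _ (row_base X)); last exact: eq_row_base.
exact/eqmx_schmidt_free/row_base_free.
Qed.

Lemma mulmx_basisK p s n (W : 'M[C]_(p, n)) (U : 'M[C]_(s, n)) :
  U \is unitarymx -> (W <= U)%MS -> W *m U^t* *m U = W.
Proof. by move=> UU /submxP[D ->]; rewrite mulmxtVK. Qed.

Lemma proj_unitary_sym s n (U : 'M[C]_(s, n)) :
  (1%:M - U^t* *m U)^t* = 1%:M - U^t* *m U.
Proof. by rewrite linearB /= map_mxB trmx_mul map_mxM trmxCK trmx1 map_mx1. Qed.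

(* Lowering the rank of [X = Y V] by projecting out [c] costs [|Y c| / |c|]. *)
Lemma cnorm_coord_ge p n (X : 'M[C]_(p, n)) (V : 'M[C]_(\rank X, n)) (tau : R) :
    V \is unitarymx -> (X <= V)%MS -> 0 <= tau ->
    (forall W : 'M[C]_(p, n), (\rank W < \rank X)%N -> tau <= cnorm (X - W)) ->
  forall s (N : 'M[C]_(\rank X, s)), tau * cnorm N <= cnorm (X *m V^t* *m N).
Proof.
move=> VU XV tau0 dist s N; set Y := X *m V^t*.
have XE : X = Y *m V by rewrite mulmx_basisK.
have colP (c : 'cV[C]_(\rank X)) : tau * cnorm c <= cnorm (Y *m c).
  have [->|c0] := eqVneq c 0; first by rewrite mulmx0 !fnorm0 mulr0.
  have cpos : 0 < cnorm c.
    rewrite lt_def fnorm_ge0 andbT; apply: contra_neq c0.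
    exact: (@fnorm_eq0 ComplexScalars).
  pose g : C := (cnorm c ^+ 2)%:C%C.
  have ccE : c^t* *m c = g%:M.
    rewrite [LHS]mx11_scalar; congr (_%:M); rewrite /g cnorm_sqrE mxtrace_mulC.
    rewrite /mxtrace big_ord1 mxE raddf_sum rmorph_sum; apply: eq_bigr => i _.
    rewrite !mxE; case: (c i 0) => a b /=; apply/eqP; rewrite eq_complex /=.
    by apply/andP; split; apply/eqP; ring.
  have g0 : g != 0 by rewrite eq_complex /= eqxx andbT expf_neq0// gt_eqF.
  (* [G] is the orthogonal projection off [c]. It kills [c], hence is singular, and [Y *m G *m V]
     has rank below that of X. *)
  pose G := 1%:M - g^-1 *: (c *m c^t*).
  have Gc : G *m c = 0.
    by rewrite mulmxBl mul1mx -scalemxAl -mulmxA ccE mul_mx_scalar scalerA mulVf// scale1r subrr.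
  have rG : (\rank (Y *m G *m V) < \rank X)%N.
    apply: (@leq_ltn_trans (\rank G)).
      by rewrite (leq_trans (mxrankM_maxl _ _))// mxrankM_maxr.
    rewrite ltn_neqAle rank_leq_row andbT; apply: contra_neqN c0 => /eqP rG.
    have Gu : G \in unitmx by rewrite -row_free_unit /row_free rG.
    by rewrite -[c](mulKmx Gu) Gc mulmx0.
  have := dist _ rG; rewrite {1}XE -mulmxBl (cnorm_mul_unitary _ VU).
  rewrite /G mulmxBr mulmx1 subKr -scalemxAr mulmxA.
  have -> : g^-1 = ((cnorm c ^+ 2)^-1)%:C%C by rewrite -fmorphV.
  rewrite cnormZ ger0_norm ?invr_ge0 ?sqr_ge0// => h.
  have {h} := le_trans h (ler_wpM2l _ (fnormM _ _)).
  rewrite invr_ge0 sqr_ge0 => /(_ isT); rewrite cnorm_trmxC => h.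
  rewrite -ler_pdivlMr//; apply: (le_trans h).
  by rewrite le_eqVlt; apply/orP; left; apply/eqP; field; rewrite gt_eqF.
rewrite -(ler_pXn2r (n := 2)) ?nnegrE ?mulr_ge0 ?fnorm_ge0// exprMn.
rewrite 2!(@fnorm_cols ComplexScalars) mulr_sumr; apply: ler_sum => j _.
rewrite -exprMn ler_pXn2r ?nnegrE ?mulr_ge0 ?fnorm_ge0//.
by rewrite (_ : col j (Y *m N) = Y *m col j N) ?colP// !colE mulmxA.
Qed.

(** As X is orthogonal to E, the claim is equivalent to |E| <= |X + E - W|. Let P project off the
    row space of W. Then |X + E - W|^2 >= |X P|^2 + |E P|^2, and what E loses on the rows of W is
    made up by |X P|, because X is at distance at least |E| from every matrix of lower rank. *)
Lemma low_rank_dot_le p n (X E W : 'M[C]_(p, n)) :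
    (forall W : 'M[C]_(p, n), (\rank W < \rank X)%N -> cnorm E <= cnorm (X - W)) ->
    X^t* *m E = 0 -> E *m X^t* = 0 -> (\rank W <= \rank X)%N ->
  2 * cdot W E <= cnorm (W - X) ^+ 2.
Proof.
move=> dist XE EX rW.
have [V VU VX] := schmidt_basis X; have [U UU UW] := schmidt_basis W.
pose P := 1%:M - U^t* *m U.
have WP : W *m P = 0.
  by rewrite mulmxBr mulmx1 mulmxA mulmx_basisK ?UW// subrr.
have XV : (X <= V)%MS by rewrite VX.
have lower : cnorm ((X + E) *m P) <= cnorm (X + E - W).
  have := cnorm_Pythagoras (X + E - W) UU; rewrite -/P mulmxBl WP subr0 => h.
  rewrite -(ler_pXn2r (n := 2)) ?nnegrE ?fnorm_ge0// h.
  by rewrite lerDl sqr_ge0.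
have cross : cnorm ((X + E) *m P) ^+ 2 = cnorm (X *m P) ^+ 2 + cnorm (E *m P) ^+ 2.
  rewrite mulmxDl fnorm_addr_sqr (_ : cdot _ _ = 0) ?mulr0 ?addr0//.
  by rewrite cdotMl mulmxA XE mul0mx dot0r.
have EP := cnorm_Pythagoras E UU; rewrite -/P in EP.
have VP := cnorm_Pythagoras V UU; rewrite -/P (cnorm_unitary VU) in VP.
have XP : cnorm E * cnorm (V *m P) <= cnorm (X *m P).
  have := cnorm_coord_ge VU XV (fnorm_ge0 _) dist (V *m P).
  by rewrite mulmxA mulmx_basisK.
have EV : E *m V^t* = 0.
  have /submxP[D ->] : (V <= X)%MS by rewrite VX.
  by rewrite trmx_mul map_mxM mulmxA EX mul0mx.
(* E V^* = 0 gives E U^* = E (1 - V^* V) U^*, so only the part of U off the row space of X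
   counts. *)
have EU : cnorm (E *m U^t*) <= cnorm E * cnorm (U *m (1%:M - V^t* *m V)).
  rewrite -[cnorm (U *m _)]cnorm_trmxC trmx_mul map_mxM proj_unitary_sym.
  apply: le_trans (fnormM _ _).
  by rewrite mulmxA mulmxBr mulmx1 mulmxA EV mul0mx subr0.
have UV := cnorm_Pythagoras U VU; rewrite (cnorm_unitary UU) in UV.
have sym : cnorm (V *m U^t*) = cnorm (U *m V^t*).
  by rewrite -cnorm_trmxC trmx_mul map_mxM trmxCK.
have rWR : (\rank W)%:R <= (\rank X)%:R :> R by rewrite ler_nat.
have XdotE : cdot X E = 0 by rewrite cdotE -[X]trmxCK -map_mxM -trmx_mul EX trmx0 map_mx0 mxtrace0.
have expand : cnorm (X + E - W) ^+ 2 = cnorm (W - X) ^+ 2 - 2 * cdot W E + cnorm E ^+ 2.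
  rewrite -[X + E - W]addrAC -opprB [- _ + E]addrC fnorm_subr_sqr.
  by rewrite dotC !dotE XdotE; ring.
have n0 := fnorm_ge0.
have e1 : cnorm E ^+ 2 <= cnorm (X + E - W) ^+ 2.
  apply: (@le_trans _ _ (cnorm ((X + E) *m P) ^+ 2)); last first.
    by rewrite ler_pXn2r ?nnegrE ?fnorm_ge0.
  rewrite cross.
  have XP2 : cnorm E ^+ 2 * cnorm (V *m P) ^+ 2 <= cnorm (X *m P) ^+ 2.
    by rewrite -exprMn ler_pXn2r ?nnegrE ?mulr_ge0 ?fnorm_ge0.
  have EU2 : cnorm (E *m U^t*) ^+ 2 <=
      cnorm E ^+ 2 * cnorm (U *m (1%:M - V^t* *m V)) ^+ 2.
    by rewrite -exprMn ler_pXn2r ?nnegrE ?mulr_ge0 ?fnorm_ge0.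
  (* By Pythagoras the two sides are rank W - |U V^*|^2 and rank X - |V U^*|^2, whose overlaps agree
     by [sym]. *)
  have cmp : cnorm (U *m (1%:M - V^t* *m V)) ^+ 2 <= cnorm (V *m P) ^+ 2.
    by rewrite sym in VP; lra.
  have := ler_wpM2l (sqr_ge0 (cnorm E)) cmp.
  lra.
lra.
Qed.
End ComplexMatrices.

(** * Singular values as lower bounds for the distance to matrices of smaller rank *)

Section SingularValueDistance.
Variable R : realType.
Local Notation C := (R[i]%C).
Local Open Scope sesquilinear_scope.
Local Notation cnorm X := (@fnorm ComplexScalars R _ _ X).

Lemma count_ge_nth_sort (s : seq R) (j : nat) : (j < size s)%N ->
  (j < count (fun x => nth 0 (sort >=%R s) j <= x)%R s)%N.
Proof.
move=> js; set t := sort >=%R s; set a := nth 0 t j.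
have szt : size t = size s by rewrite size_sort.
have tot : total (>=%R : rel R) by move=> x y; exact: le_total.
have tr : transitive (>=%R : rel R) by move=> y x z xy yz; exact: le_trans yz xy.
have srt : sorted >=%R t by exact: sort_sorted.
rewrite -(permP (_ : perm_eq t s)); last by rewrite /t perm_sort.
rewrite -[X in count _ X](cat_take_drop j.+1 t) count_cat.
apply: leq_trans (leq_addr _ _).
suff : all (fun x => a <= x) (take j.+1 t).
  rewrite all_count => /eqP ->.
  by rewrite size_takel ?szt.
apply/(all_nthP 0) => i; rewrite size_takel ?szt// => ij.
rewrite nth_take//; apply: (sorted_leq_nth tr (@lexx _ R) 0 srt) => //.
- by rewrite inE szt (leq_ltn_trans _ js).
- by rewrite inE szt.
Qed.

Lemma spectral_Gram_quadratic p n (X : 'M[C]_(p, n)) (v : 'rV[C]_n) :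
  let P := spectralmx (X^t* *m X) in
  let lambda := spectral_diag (X^t* *m X) in
  cnorm (X *m v^t*) ^+ 2 =
    \sum_i complex.Re (lambda 0 i) * modulus (k := ComplexScalars) ((v *m P^t*) 0 i) ^+ 2.
Proof.
move=> P lambda.
have PU : P \is unitarymx := spectral_unitarymx _.
have nX : X^t* *m X \is normalmx.
  by apply/normalmxP; rewrite trmx_mul map_mxM trmxCK.
have GE : X^t* *m X = P^t* *m diag_mx lambda *m P.
  by rewrite -invmx_unitary//; exact/orthomx_spectralP.
rewrite cnorm_sqrE trmx_mul map_mxM trmxCK mxtrace_mulC mulmxA.
rewrite -[v *m _ *m _]mulmxA GE !mulmxA.
set w := v *m P^t*.
have -> : w *m diag_mx lambda *m P *m v^t* = w *m diag_mx lambda *m w^t*.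
  by rewrite /w trmx_mul map_mxM trmxCK !mulmxA.
rewrite /mxtrace big_ord1 mxE raddf_sum; apply: eq_bigr => i _.
rewrite mul_mx_diag !mxE modulus_sqr /re /im /=.
set x := \sum_j _; case: x (lambda 0 i) => a b [c d] /=; ring.
Qed.

(** At least j right singular vectors have singular value at least s = sigma_j(X). As rank W < j,
    some nonzero v in their span satisfies W v^* = 0, and then s |v| <= |X v^*| = |(X - W) v^*| <=
    |X - W| |v|. *)
Lemma sigma_le_dist (k : field_kind) p n (j : nat)
    (X : 'M[base_field k R]_(p, n)) (W : 'M[C]_(p, n)) :
  (\rank W < j)%N -> sigma j X <= cnorm (complexify X - W).
Proof.
move=> rW; rewrite leNgt; apply/negP => lt_s.
have s0 : 0 < sigma j X by exact: le_lt_trans (fnorm_ge0 _) lt_s.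
move: s0 lt_s; rewrite /sigma /singular_values.
set XC : 'M[C]_(p, n) := map_mx _ X; set lambda := spectral_diag _.
set L := [seq _ | _ : 'I_n].
(* Past the last singular value [nth] returns its default 0, against [s0]. *)
have [jm|jm] := ltnP j.-1 (minn p n); last first.
  rewrite nth_default ?ltxx// size_take size_sort (leq_trans _ jm)//.
  by case: ifP => // /negbT; rewrite -leqNgt.
rewrite nth_take//; set s := nth 0 _ _ => s0 lt_s.
have jn : (j.-1 < size L)%N.
  by rewrite size_map size_enum_ord (leq_trans jm)// geq_minr.
have := count_ge_nth_sort jn; rewrite -/s prednK; last by case: (j) rW.
pose J := [set i | s <= Num.sqrt (complex.Re (lambda 0 i))]%SET.
rewrite count_map (_ : count _ _ = #|J|); last first.
  by rewrite -sum1_count big_enum_cond /= -sum1_card; apply: eq_bigl => i; rewrite inE.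
move=> jJ; pose P := spectralmx (XC^t* *m XC).
have PU : P \is unitarymx := spectral_unitarymx _.
pose f : 'I_#|J| -> 'I_n := enum_val.
have SE : rowsub f P *m P^t* = rowsub f 1%:M.
  by rewrite mul_rowsub_mx (unitarymxP PU).
have SU : rowsub f P \is unitarymx.
  apply/unitarymxP/matrixP => a b; rewrite !mxE.
  have /matrixP /(_ (f a) (f b)) := unitarymxP PU; rewrite !mxE (inj_eq enum_val_inj) => <-.
  by apply: eq_bigr => i _; rewrite !mxE.
have : kermx (rowsub f P *m W^t*) != 0.
  rewrite kermx_eq0; apply: contraTN jJ => /eqP rJ.
  rewrite -ltnNge -rJ (leq_ltn_trans (mxrankM_maxr _ _))//.
  by rewrite mxrank_map mxrank_tr.
move/rowV0Pn => [u /sub_kermxP uM u0].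
pose v := u *m rowsub f P.
have Wv : W *m v^t* = 0.
  have /(congr1 (fun M => M^t*)) := uM.
  by rewrite mulmxA trmx_mul map_mxM trmxCK trmx0 map_mx0.
have vpos : 0 < cnorm v.
  rewrite (cnorm_mul_unitary _ SU) lt_def fnorm_ge0 andbT.
  by apply: contra_neq u0; exact: (@fnorm_eq0 ComplexScalars).
have le1 : s * cnorm v <= cnorm (XC *m v^t*).
  rewrite -(ler_pXn2r (n := 2)) ?nnegrE ?mulr_ge0 ?fnorm_ge0 ?(ltW s0)// exprMn.
  rewrite spectral_Gram_quadratic -/P -/lambda.
  have -> : cnorm v = cnorm (v *m P^t*).
    by rewrite (cnorm_mul_unitary v) ?trmxC_unitary.
  rewrite fnorm_sqrE big_ord1 mulr_sumr; apply: ler_sum => i _.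
  have [iJ|iJ] := boolP (i \in J).
    rewrite ler_wpM2r ?sqr_ge0//; move: iJ; rewrite inE => si.
    (* [Num.sqrt] is 0 at negative numbers, so s > 0 forces this eigenvalue to have positive real
       part. *)
    have lpos : 0 < complex.Re (lambda 0 i) by rewrite -sqrtr_gt0 (lt_le_trans s0).
    by rewrite -[leRHS]sqr_sqrtr ?(ltW lpos)// ler_pXn2r ?nnegrE ?sqrtr_ge0 ?(ltW s0).
  suff -> : (v *m P^t*) 0 i = 0 by rewrite modulus0 expr0n !mulr0.
  rewrite -mulmxA SE mxE big1// => l _; rewrite !mxE.
  case: eqP => [il|_]; last by rewrite mulr0.
  by move: iJ; rewrite -il enum_valP.
have le2 : cnorm (XC *m v^t*) <= cnorm (XC - W) * cnorm v.
  have -> : XC *m v^t* = (XC - W) *m v^t* by rewrite mulmxBl Wv subr0.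
  by rewrite -[cnorm v]cnorm_trmxC (@fnormM ComplexScalars).
have := le_trans le1 le2; rewrite ler_pM2r// leNgt => /negP; apply.
exact: lt_s.
Qed.

End SingularValueDistance.

(** * Existence of minimizers under a rank bound, by compactness *)

Section LowRankMinimizers.
Variables (k : field_kind) (R : realType).
Local Notation F := (base_field k R).

(** One-sided inverses of the factors of X give L X M = 1 of size rank X. For Y near X, L Y M is 1
    plus a matrix of norm < 1, hence still invertible. *)
Lemma rank_lower_semicontinuous p q (X : 'M[F]_(p, q)) :
  exists2 e : R, 0 < e &
    forall Y, fnorm (Y - X) < e -> (\rank X <= \rank Y)%N.
Proof.
pose L := pinvmx (col_base X); pose M := pinvmx (row_base X).
have LXM : L *m X *m M = 1%:M.
  rewrite -[X in L *m X *m M]mulmx_base mulmxA mulVpmx ?col_base_full//.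
  by rewrite mul1mx mulmxVp// row_base_free.
have LM0 : 0 < fnorm L * fnorm M + 1 by rewrite ltr_wpDl ?mulr_ge0 ?fnorm_ge0.
exists (fnorm L * fnorm M + 1)^-1; first by rewrite invr_gt0.
move=> Y YX; pose N := L *m (Y - X) *m M.
have N1 : fnorm N < 1.
  apply: le_lt_trans (fnormM _ _) _.
  apply: le_lt_trans (ler_wpM2r (fnorm_ge0 _) (fnormM _ _)) _.
  rewrite mulrAC mulrC -(divff (lt0r_neq0 LM0)).
  have h := ltW YX.
  apply: (@le_lt_trans _ _ ((fnorm L * fnorm M + 1)^-1 * (fnorm L * fnorm M))).
    by rewrite ler_wpM2r ?mulr_ge0 ?fnorm_ge0.
  by rewrite mulrC ltr_pM2r ?invr_gt0// ltrDl.
have NE : L *m Y *m M = 1%:M + N.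
  by rewrite /N mulmxBr mulmxBl LXM addrC subrK.
have : row_free (L *m Y *m M).
  rewrite -kermx_eq0; apply/negPn/negP => /rowV0Pn[v /sub_kermxP].
  rewrite NE mulmxDr mulmx1 => /eqP; rewrite addr_eq0 => /eqP vN.
  move=> /negP; apply; apply/eqP/fnorm_eq0/eqP; apply: contraTT N1 => v0.
  have {v0} v0 : 0 < fnorm v by rewrite lt_def v0 fnorm_ge0.
  by rewrite -leNgt -(ler_pM2l v0) mulr1 {1}vN fnormN fnormM.
rewrite /row_free => /eqP <-.
by rewrite (leq_trans (mxrankM_maxl _ _))// mxrankM_maxr.
Qed.

Section Coordinates.
Variables n1 n2 : nat.

(** Real coordinates move the problem to real row vectors, where closed bounded sets are compact.
    Real parts precede imaginary parts in each row; over real scalars the latter are ignored. *)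
Definition mx_of_coords (v : 'rV[R]_(n1 * (n2 + n2))) : 'M[F]_(n1, n2) :=
  \matrix_(i, j) of_coords k (vec_mx v i (lshift n2 j)) (vec_mx v i (rshift n2 j)).

Definition mx_coords (X : 'M[F]_(n1, n2)) : 'rV[R]_(n1 * (n2 + n2)) :=
  mxvec (row_mx (map_mx (@re k R) X) (map_mx (@im k R) X)).

Lemma mx_coordsK X : mx_of_coords (mx_coords X) = X.
Proof.
apply/matrixP => i j.
by rewrite mxE mxvecK row_mxEl row_mxEr !mxE of_coordsK.
Qed.

Lemma mx_of_coordsB u v : mx_of_coords (u - v) = mx_of_coords u - mx_of_coords v.
Proof. by apply/matrixP => i j; rewrite !mxE; case: k. Qed.

Lemma norm_mx_coords X : `|mx_coords X| <= fnorm X.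
Proof.
have entry i j : re (X i j) ^+ 2 + im (X i j) ^+ 2 <= fnorm X ^+ 2.
  rewrite -modulus_sqr fnorm_sqrE (bigD1 i)//= (bigD1 j)//= -addrA lerDl.
  rewrite addr_ge0// sumr_ge0// => l _; rewrite ?sqr_ge0//.
  by rewrite sumr_ge0// => ? _; rewrite sqr_ge0.
have abs_le (a : R) : a ^+ 2 <= fnorm X ^+ 2 -> `|a| <= fnorm X.
  by rewrite -(real_normK (num_real a)) ler_pXn2r ?nnegrE ?fnorm_ge0.
rewrite [leLHS]/Num.Def.normr/= mx_normrE; apply: bigmax_le => [|ol _].
  exact: fnorm_ge0.
case: ol => o l /=; rewrite (ord1 o); case: (mxvec_indexP l) => i j; rewrite mxvecE.
apply: abs_le; rewrite mxE; case: (fintype.split j) => h; rewrite mxE;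
  apply: le_trans (entry i h); by rewrite ?lerDl ?lerDr sqr_ge0.
Qed.

Lemma fnorm_mx_of_coords :
  exists2 c : R, 0 < c & forall v, fnorm (mx_of_coords v) <= c * `|v|.
Proof.
have entry (v : 'rV[R]_(n1 * (n2 + n2))) i j : vec_mx v i j ^+ 2 <= `|v| ^+ 2.
  rewrite -(real_normK (num_real (vec_mx v i j))) ler_pXn2r ?nnegrE//.
  rewrite [leRHS]/Num.Def.normr/= mx_normrE; apply/bigmax_geP; right.
  by exists (0, mxvec_index i j) => //=; rewrite mxE.
(* Each entry has squared modulus at most 2 |v|^2, and with a = 2 n1 n2 the bound a <= (a + 1)^2
   avoids a square root. *)
exists ((n1 * n2)%:R * 2 + 1); first by rewrite ltr_wpDl ?mulr_ge0.
move=> v; rewrite -(ler_pXn2r (n := 2)) ?nnegrE ?mulr_ge0 ?addr_ge0 ?mulr_ge0 ?fnorm_ge0//.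
rewrite fnorm_sqrE exprMn.
apply: (@le_trans _ _ (\sum_(i < n1) \sum_(j < n2) 2 * `|v| ^+ 2)).
  apply: ler_sum => i _; apply: ler_sum => j _; rewrite modulus_sqr mxE re_of_coords.
  have h1 := entry v i (lshift n2 j); have h2 := entry v i (rshift n2 j).
  suff : im (of_coords k (vec_mx v i (lshift n2 j)) (vec_mx v i (rshift n2 j))) ^+ 2
    <= vec_mx v i (rshift n2 j) ^+ 2 by lra.
  by case: k; rewrite /im //= expr0n sqr_ge0.
rewrite !sumr_const !card_ord -!mulrnA -[leLHS]mulr_natl mulnC mulrA.
rewrite ler_wpM2r ?sqr_ge0//; set a := _ * 2.
have a0 : 0 <= a by rewrite mulr_ge0.
by rewrite sqrrD1; have := sqr_ge0 a; rewrite mulr2n; lra.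
Qed.

End Coordinates.

(** The rank bound defines a closed set by semicontinuity of the rank. It contains 0, so only
    matrices with f <= f 0 compete, and these lie in a ball of radius rho. *)
Lemma low_rank_min n1 n2 K (f : 'M[F]_(n1, n2) -> R) (c rho : R) :
    (forall X Y, `|f X - f Y| <= c * fnorm (X - Y)) ->
    (forall X, (\rank X <= K)%N -> f X <= f 0 -> fnorm X <= rho) ->
  exists2 X, (\rank X <= K)%N & forall Y, (\rank Y <= K)%N -> f X <= f Y.
Proof.
move=> flip fcoer.
have [d d0 phi_le] := fnorm_mx_of_coords n1 n2.
pose phi := @mx_of_coords n1 n2.
pose S := [set v | `|v| <= rho] `&` [set v | (\rank (phi v) <= K)%N].
have phi0 : phi 0 = 0 by rewrite -[0 in LHS](subrr 0) /phi mx_of_coordsB subrr.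
have rank0 : (\rank (0%R : 'M[F]_(n1, n2)) <= K)%N by rewrite mxrank0.
have S0 : S 0.
  by split => /=; rewrite ?phi0// normr0 -(@fnorm0 k R n1 n2) fcoer.
have Sclosed : closed S.
  apply: closedI.
    have := @closed_closed_ball_ R _ (0 : 'rV[R]_(n1 * (n2 + n2))) rho.
    rewrite /closed_ball_; congr closed; apply/seteqP.
    by split => v /=; rewrite sub0r normrN.
  rewrite -[X in closed X]setCK closedC openE => v /= /negP; rewrite -ltnNge => Kv.
  have [e e0 he] := rank_lower_semicontinuous (phi v).
  rewrite /interior /= -nbhs_nbhs_norm; exists (e / d) => /=; first by rewrite divr_gt0.
  move=> w /=; rewrite distrC => vw; apply/negP; rewrite -ltnNge.
  apply: (leq_trans Kv); apply: he; rewrite /phi -mx_of_coordsB.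
  by rewrite (le_lt_trans (phi_le _))// mulrC -ltr_pdivlMr.
have Scompact : compact S.
  apply: bounded_closed_compact => //.
  exists rho; split; first exact: num_real.
  by move=> x rx v [/= vr _]; rewrite (le_trans vr)// ltW.
have fcont : continuous (f \o phi : 'rV[R]_(n1 * (n2 + n2)) -> R).
  move=> v; apply/(cvgrPdist_lt (FF := nbhs_filter v)) => e e0.
  suff : \forall w \near v, `|f (phi v) - f (phi w)| < e by [].
  apply/nbhs_normP.
  have c1 : 0 < (`|c| + 1) * d by rewrite mulr_gt0// ltr_wpDl.
  exists (e / ((`|c| + 1) * d)) => /=; first by rewrite divr_gt0.
  move=> w /=; rewrite ltr_pdivlMr// => vw; apply: le_lt_trans (flip _ _) _.
  apply: le_lt_trans vw; rewrite /phi -mx_of_coordsB [leRHS]mulrCA.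
  apply: (@le_trans _ _ ((`|c| + 1) * fnorm (mx_of_coords (v - w)))).
    by rewrite ler_wpM2r ?fnorm_ge0// (le_trans (ler_norm c))// lerDl.
  by rewrite ler_wpM2l ?addr_ge0// mulrC.
have [v vS vmin] := EVT_min_rV (ex_intro _ 0 S0) Scompact (continuous_subspaceT fcont).
move: vS; rewrite inE => -[_ rv]; exists (phi v) => // Y rY.
have [fY|fY] := leP (f Y) (f 0).
  rewrite -[Y]mx_coordsK; apply: vmin; rewrite inE; split=> /=.
    exact: le_trans (norm_mx_coords _) (fcoer _ rY fY).
  by rewrite /phi mx_coordsK.
apply: le_trans (ltW fY); rewrite -phi0; apply: vmin; rewrite inE; exact: S0.
Qed.

End LowRankMinimizers.

(** * The quadratic envelope of the rank constraint *)

Section QuadraticEnvelope.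
Variables (k : field_kind) (R : realType) (n1 n2 K : nat).
Local Notation F := (base_field k R).
Local Notation M := 'M[F]_(n1, n2).
Local Notation iotaK := (iota_set R (@rank_le k R n1 n2 K)).
Implicit Types X Y W : M.

Lemma iota_rank_in W : (\rank W <= K)%N -> iotaK W = 0%E.
Proof. by move=> rW; rewrite /iota_set mem_set. Qed.

(** [- S2 iotaK Y] is the squared distance from Y to R_K. This lemma bounds it from below and
    [S2_iota_ge] from above. *)
Lemma S2_iota_le Y (d : R) :
  (forall W, (\rank W <= K)%N -> d <= fnorm (W - Y) ^+ 2) ->
  (S2 iotaK Y <= (- d)%:E)%E.
Proof.
move=> h; apply: ge_ereal_sup => _ [W _ <-]; rewrite /iota_set.
case: ifPn => [|_]; last by rewrite /= leNye.
by rewrite inE => rW; rewrite oppe0 add0e -EFinN lee_fin lerN2 h.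
Qed.

Lemma S2_iota_ge Y W : (\rank W <= K)%N ->
  ((- fnorm (W - Y) ^+ 2)%:E <= S2 iotaK Y)%E.
Proof.
move=> rW; apply: ereal_sup_ubound; exists W => //.
by rewrite iota_rank_in// oppe0 add0e.
Qed.

Lemma Q2_iota_ge X Y (d : R) :
  (forall W, (\rank W <= K)%N -> d <= fnorm (W - Y) ^+ 2) ->
  ((d - fnorm (Y - X) ^+ 2)%:E <= Q2 iotaK X)%E.
Proof.
move=> /S2_iota_le h; apply: le_trans (ereal_sup_ubound _); last by exists Y.
by rewrite EFinB leeB// leeNr -EFinN.
Qed.

Lemma Q2_iota_leP X (q : R) :
  (Q2 iotaK X <= q%:E)%E <->
  forall Y, (- S2 iotaK Y <= (q + fnorm (Y - X) ^+ 2)%:E)%E.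
Proof.
split=> [h Y|h].
  rewrite EFinD -leeBlDr//; apply: le_trans h.
  by apply: ereal_sup_ubound; exists Y.
by apply: ge_ereal_sup => _ [Y _ <-]; rewrite leeBlDr// -EFinD.
Qed.

Lemma Q2_iota_le0 X : (\rank X <= K)%N -> (Q2 iotaK X <= 0)%E.
Proof.
move=> rX; apply/Q2_iota_leP => Y.
by rewrite add0r leeNl -EFinN fnormB S2_iota_ge.
Qed.

Lemma Q2_iota_ge0 X : (0 <= Q2 iotaK X)%E.
Proof.
have := @Q2_iota_ge X X 0 (fun W _ => sqr_ge0 _).
by rewrite subrr fnorm0 expr0n subr0.
Qed.

Lemma Q2_iota_rank_le X : (\rank X <= K)%N -> Q2 iotaK X = 0%E.
Proof. by move=> rX; apply/eqP; rewrite eq_le Q2_iota_le0// Q2_iota_ge0. Qed.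

(* This is the convexity of [Q2 iotaK X + |X|^2], with the quadratic terms collected. *)
Lemma Q2_iota_convex X W (q1 q2 t : R) : 0 <= t <= 1 ->
  (Q2 iotaK X <= q1%:E)%E -> (Q2 iotaK W <= q2%:E)%E ->
  (Q2 iotaK (X + emb k t *: (W - X))
    <= ((1 - t) * q1 + t * q2 + t * (1 - t) * fnorm (W - X) ^+ 2)%:E)%E.
Proof.
move=> /andP[t0 t1] /Q2_iota_leP hX /Q2_iota_leP hW; apply/Q2_iota_leP => Y.
(* On the segment, the squared distance to Y falls below its chord by exactly t (1 - t) |W -
   X|^2. *)
have hY : ((1 - t) * (q1 + fnorm (Y - X) ^+ 2) + t * (q2 + fnorm (Y - W) ^+ 2)
  = (1 - t) * q1 + t * q2 + t * (1 - t) * fnorm (W - X) ^+ 2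
    + fnorm (Y - (X + emb k t *: (W - X))) ^+ 2).
  rewrite opprD addrA -[Y - W](subrKA X) -[X - W]opprB.
  move: (Y - X) (W - X) => P D.
  by rewrite !fnorm_subr_sqr dotZr fnormZ exprMn real_normK ?num_real//; ring.
rewrite -hY; case: (- S2 iotaK Y)%E (hX Y) (hW Y) => [u| |]; last 2 first.
- by rewrite leye_eq => /eqP.
- by rewrite !leNye.
rewrite !lee_fin => h1 h2.
have -> : u = (1 - t) * u + t * u by ring.
by apply: lerD; apply: ler_wpM2l; rewrite ?subr_ge0.
Qed.

Lemma emb1 : emb k (1 : R) = 1.
Proof. by apply: coords_inj; rewrite ?re_emb ?im_emb /re /im rmorph1. Qed.

(** The envelope is 0 at matrices with a single nonzero entry, which have rank at most 1 <= K, and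
    convexity carries finiteness to sums. [P] quantifies over all multiples because Y + W is the
    midpoint of 2 Y and 2 W. *)
Lemma Q2_iota_finite X : (0 < K)%N -> exists q : R, (Q2 iotaK X <= q%:E)%E.
Proof.
move=> K0; pose P X := forall c : R, exists q : R, (Q2 iotaK (emb k c *: X) <= q%:E)%E.
have PD Y W : P Y -> P W -> P (Y + W).
  move=> PY PW c; have [q1 h1] := PY (2 * c); have [q2 h2] := PW (2 * c).
  have t01 : 0 <= (2^-1 : R) <= 1 by apply/andP; split; lra.
  have := Q2_iota_convex t01 h1 h2.
  have -> : emb k (2 * c) *: Y
      + emb k 2^-1 *: (emb k (2 * c) *: W - emb k (2 * c) *: Y) = emb k c *: (Y + W).
    apply/matrixP => i j; rewrite !mxE.
    by apply: coords_inj; rewrite !(reD, imD, reM, imM, reN, imN, re_emb, im_emb); field.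
  by move=> h; eexists; exact: h.
suff PX : P X by have := PX 1; rewrite emb1 scale1r.
have P0 : P 0.
  by move=> c; exists 0; rewrite scaler0 Q2_iota_le0// mxrank0.
rewrite (matrix_sum_delta X).
apply: (big_ind P) => [||i _]; [exact: P0|exact: PD|].
apply: (big_ind P) => [||j _ c]; [exact: P0|exact: PD|].
exists 0; apply: Q2_iota_le0; rewrite scalerA (leq_trans (rank_scale_le _ _))//.
by rewrite mxrank_delta.
Qed.

End QuadraticEnvelope.

(** * Stationarity of minimizers and uniqueness of stationary points *)

Section StationaryPoints.
Variables (k : field_kind) (R : realType) (n1 n2 m K : nat).
Local Notation F := (base_field k R).
Local Notation M := 'M[F]_(n1, n2).
Variables (A : {linear M -> 'cV[F]_m}) (b : 'cV[F]_m).
Implicit Types X Y W E V : M.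

(** This pins down E = A^*(b - A X), minus half the gradient of the data term, by its pairings. *)
Definition residual_gradient X E := forall V, dot V E = dot (A V) (b - A X).

(** This is |X - (X + E)|^2 <= |W - (X + E)|^2 with the squares expanded. *)
Definition stationary X E :=
  forall W, (\rank W <= K)%N -> 2 * dot (W - X) E <= fnorm (W - X) ^+ 2.

Hypothesis contractive : forall X, X != 0 -> fnorm (A X) < fnorm X.

Lemma contractive_le X : fnorm (A X) <= fnorm X.
Proof.
have [->|X0] := eqVneq X 0; first by rewrite linear0 !fnorm0.
exact/ltW/contractive.
Qed.

Lemma residual_gradient_exists X : exists E, residual_gradient X E.
Proof. exact: adjoint_exists. Qed.

Lemma residual_sqr X E W : residual_gradient X E ->
  fnorm (A W - b) ^+ 2 =
  fnorm (A X - b) ^+ 2 - 2 * dot (W - X) E + fnorm (A (W - X)) ^+ 2.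
Proof.
move=> XE; have -> : A W - b = A (W - X) - (b - A X).
  by rewrite linearB /= opprB addrA subrK.
by rewrite fnorm_subr_sqr XE fnormB; ring.
Qed.

Lemma dist_fnorm_le p q (X Y Z : 'M[F]_(p, q)) :
  `|fnorm (X - Z) - fnorm (Y - Z)| <= fnorm (X - Y).
Proof.
have h1 := fnorm_triangle Y X Z; have h2 := fnorm_triangle X Y Z.
by rewrite ler_norml (fnormB Y X) in h2 *; apply/andP; split; lra.
Qed.

Lemma low_rank_projection Z : exists2 W, (\rank W <= K)%N &
  forall V, (\rank V <= K)%N -> fnorm (W - Z) <= fnorm (V - Z).
Proof.
apply: (@low_rank_min k R n1 n2 K (fun X => fnorm (X - Z)) 1 (2 * fnorm Z)).
  by move=> X Y; rewrite mul1r; exact: dist_fnorm_le.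
move=> X _; rewrite sub0r fnormN => h.
by have := fnormD (X - Z) Z; rewrite subrK; lra.
Qed.

Lemma Q2_iota_ge_projection X E W :
  (forall V, (\rank V <= K)%N -> fnorm (W - (X + E)) <= fnorm (V - (X + E))) ->
  ((fnorm (W - X) ^+ 2 - 2 * dot (W - X) E)%:E
    <= Q2 (iota_set R (@rank_le k R n1 n2 K)) X)%E.
Proof.
move=> Wmin; have -> : fnorm (W - X) ^+ 2 - 2 * dot (W - X) E =
    fnorm (W - (X + E)) ^+ 2 - fnorm (X + E - X) ^+ 2.
  by rewrite addrAC subrr add0r opprD addrA [in RHS]fnorm_subr_sqr addrK.
apply: Q2_iota_ge => V rV.
by rewrite ler_pXn2r ?nnegrE ?fnorm_ge0// Wmin.
Qed.

Lemma Rreg_rank_le X : (\rank X <= K)%N -> Rreg A b K X = (fnorm (A X - b) ^+ 2)%:E.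
Proof. by move=> rX; rewrite /Rreg Q2_iota_rank_le// add0e. Qed.

(** W is a projection of X + E onto R_K; the terms linear in E cancel between the envelope bound and
    the expansion of the data term at W. *)
Lemma Rreg_ge X : exists2 W, (\rank W <= K)%N &
  ((fnorm (A W - b) ^+ 2 + (fnorm (W - X) ^+ 2 - fnorm (A (W - X)) ^+ 2))%:E
    <= Rreg A b K X)%E.
Proof.
have [E XE] := residual_gradient_exists X.
have [W rW Wmin] := low_rank_projection (X + E); exists W => //.
rewrite /Rreg; have := Q2_iota_ge_projection Wmin => h.
apply: le_trans (leeD2r _ h); rewrite -EFinD lee_fin (residual_sqr W XE).
by rewrite le_eqVlt; apply/orP; left; apply/eqP; ring.
Qed.

Lemma Rreg_argmin XB : (\rank XB <= K)%N ->
    (forall W, (\rank W <= K)%N -> fnorm (A XB - b) <= fnorm (A W - b)) ->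
    (forall X, (\rank X <= K)%N ->
      (forall W, (\rank W <= K)%N -> fnorm (A X - b) <= fnorm (A W - b)) -> X = XB) ->
  argmin [set: M] (Rreg A b K) = [set XB].
Proof.
move=> rXB XBmin XBuniq.
have sqr_min W : (\rank W <= K)%N -> fnorm (A XB - b) ^+ 2 <= fnorm (A W - b) ^+ 2.
  by move=> rW; rewrite ler_pXn2r ?nnegrE ?fnorm_ge0// XBmin.
have AD W X : fnorm (A (W - X)) ^+ 2 <= fnorm (W - X) ^+ 2.
  by rewrite ler_pXn2r ?nnegrE ?fnorm_ge0// contractive_le.
apply/seteqP; split=> [X [_ Xmin]|_ ->]; last first.
  split=> // X _; have [W rW] := Rreg_ge X; apply: le_trans.
  rewrite Rreg_rank_le// lee_fin.
  by have := sqr_min W rW; have := AD W X; lra.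
have [W rW] := Rreg_ge X; move/le_trans => /(_ _ (Xmin XB I)).
rewrite Rreg_rank_le// lee_fin => h.
(* Strict contraction makes the excess |W - X|^2 - |A (W - X)|^2 positive unless W = X. *)
have WX : W = X.
  apply/eqP; rewrite -subr_eq0; apply: contraT => /contractive.
  rewrite -(ltr_pXn2r (n := 2)) ?nnegrE ?fnorm_ge0// => lt.
  by have := sqr_min W rW; lra.
rewrite WX subrr linear0 !fnorm0 expr0n subr0 addr0 in rW h.
apply: XBuniq => // V rV; apply: le_trans (XBmin V rV).
by move: h; rewrite ler_pXn2r ?nnegrE ?fnorm_ge0.
Qed.

Lemma low_rank_minimizer_stationary X E : residual_gradient X E ->
  (forall W, (\rank W <= K)%N -> fnorm (A X - b) <= fnorm (A W - b)) ->
  stationary X E.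
Proof.
move=> XE Xmin W /Xmin.
rewrite -(ler_pXn2r (n := 2)) ?nnegrE ?fnorm_ge0// (residual_sqr W XE) => h.
have : fnorm (A (W - X)) ^+ 2 <= fnorm (W - X) ^+ 2.
  by rewrite ler_pXn2r ?nnegrE ?fnorm_ge0// contractive_le.
lra.
Qed.

(* If [W] is a best rank [K] approximation of [X + E], the quadratic envelope
   lies below its chord on the segment [[X, W]], and along it [Rreg] has slope at
   most 0 and is strictly concave; so a local minimizer [X] is equal to [W]. *)
Lemma local_minimizer_stationary X E : (0 < K)%N -> residual_gradient X E ->
  local_minimizers (Rreg A b K) X -> (\rank X <= K)%N /\ stationary X E.
Proof.
move=> K0 XE [rho rho0 Xmin].
have [W rW Wmin] := low_rank_projection (X + E).
suff WX : W = X.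
  split=> [|V rV]; first by rewrite -WX.
  have := Wmin V rV; rewrite WX opprD !addrA subrr sub0r fnormN.
  rewrite -(ler_pXn2r (n := 2)) ?nnegrE ?fnorm_ge0//.
  rewrite (fnorm_subr_sqr (V - X) E); lra.
apply/eqP; rewrite -subr_eq0; apply: contraT => D0.
have := contractive D0; have := Q2_iota_ge_projection Wmin.
have [q0 hq0] := Q2_iota_finite X K0.
have qge := Q2_iota_ge0 K X.
set Q := Q2 _ X in hq0 qge *; have Qfin : Q = (fine Q)%:E.
  by rewrite fineK// ge0_fin_numE// (le_lt_trans hq0) ?ltry.
move: (fine Q) Qfin => q {q0 qge hq0} QE; rewrite QE lee_fin.
set D := W - X in D0 * => qD AD.
have Dpos : 0 < 2 * (fnorm D + 1) by rewrite mulr_gt0// ltr_wpDl ?fnorm_ge0.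
(* The second term keeps X + t D within [rho] of X, as 2 (|D| + 1) > |D|. *)
pose t := Num.min 1 (rho / (2 * (fnorm D + 1))).
have t0 : 0 < t by rewrite lt_min ltr01 divr_gt0.
have t1 : t <= 1 by rewrite ge_min lexx.
have t01 : 0 <= t <= 1 by rewrite ltW.
have tD : fnorm (X + emb k t *: D - X) < rho.
  rewrite addrAC subrr add0r fnormZ gtr0_norm//.
  have tr : t <= rho / (2 * (fnorm D + 1)) by rewrite ge_min lexx orbT.
  rewrite ler_pdivlMr// in tr; apply: lt_le_trans tr.
  by rewrite ltr_pM2l//; have := fnorm_ge0 D; lra.
have := Xmin _ tD; rewrite /Rreg -/Q QE.
have := Q2_iota_convex t01 (_ : (Q <= q%:E)%E) (Q2_iota_le0 rW).
rewrite QE => /(_ (lexx _)); rewrite -/D mulr0 addr0 => up lo.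
have := le_trans lo (leeD2r _ up).
rewrite -!EFinD lee_fin (residual_sqr (X + emb k t *: D) XE).
rewrite [X + _ - X]addrAC subrr add0r dotZl [A (_ *: _)]linearZ fnormZ exprMn.
rewrite real_normK ?num_real// => ineq.
move: AD; rewrite -(ltr_pXn2r (n := 2)) ?nnegrE ?fnorm_ge0// => AD.
(* By [qD] the terms linear in t sum to at most 0, leaving 0 <= t^2 (|A D|^2 - |D|^2), against
   [tAD]. *)
have tq := ler_wpM2l (ltW t0) qD.
have t2 : 0 < t ^+ 2 by rewrite exprn_gt0.
have tAD : t ^+ 2 * fnorm (A D) ^+ 2 < t ^+ 2 * fnorm D ^+ 2 by rewrite ltr_pM2l.
nra.
Qed.

(** Along the line, 2 t <V, E> <= t^2 |V|^2 for t of both signs, so the linear coefficient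
    vanishes. *)
Lemma stationary_direction X E V : stationary X E ->
  (forall t : R, (\rank (X + emb k t *: V)%R <= K)%N) -> dot V E = 0.
Proof.
move=> XE rV.
have h t : 2 * (t * dot V E) <= t ^+ 2 * fnorm V ^+ 2.
  have := XE _ (rV t); rewrite addrAC subrr add0r dotZl fnormZ exprMn.
  by rewrite real_normK ?num_real.
set a := dot V E in h *; set v := fnorm V ^+ 2 in h.
have v0 : 0 <= v := sqr_ge0 _.
have v1 : 0 < v + 1 by lra.
apply/eqP; apply: contraT => a0; have := h (a / (v + 1)).
have a2 : 0 < a ^+ 2 by rewrite exprn_even_gt0.
have -> : 2 * (a / (v + 1) * a) = (a ^+ 2 / (v + 1) ^+ 2) * (2 * (v + 1)).
  by field; rewrite gt_eqF.
have -> : (a / (v + 1)) ^+ 2 * v = (a ^+ 2 / (v + 1) ^+ 2) * v.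
  by field; rewrite gt_eqF.
rewrite ler_pM2l; last by rewrite divr_gt0// exprn_gt0.
lra.
Qed.

(** X + t X Z = X (1 + t Z) stays in R_K for all t, and likewise on the left. These are weak forms
    of X^* E = 0 and E X^* = 0. *)
Lemma stationary_orthogonal X E : (\rank X <= K)%N -> stationary X E ->
  (forall Z : 'M[F]_n2, dot (X *m Z) E = 0) /\
  (forall Z : 'M[F]_n1, dot (Z *m X) E = 0).
Proof.
move=> rX XE; split=> Z; apply: (stationary_direction XE) => t;
  apply: leq_trans _ rX.
- have -> : X + emb k t *: (X *m Z) = X *m (1%:M + emb k t *: Z).
    by rewrite mulmxDr mulmx1 scalemxAr.
  exact: mxrankM_maxl.
- have -> : X + emb k t *: (Z *m X) = (1%:M + emb k t *: Z) *m X.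
    by rewrite mulmxDl mul1mx scalemxAl.
  exact: mxrankM_maxr.
Qed.

(* [|A (X - XB)|^2 = <E - EB, XB - X>] is at most
   [(1 + s) / 2 * |X - XB|^2 < (1 - delta) * |X - XB|^2]. *)
Lemma stationary_unique XB EB X E (delta s : R) :
    residual_gradient XB EB -> residual_gradient X E ->
    stationary X E -> (\rank X <= K)%N -> (\rank XB <= K)%N ->
    dot XB EB = 0 -> s < 1 - 2 * delta ->
    (forall W, (\rank W <= K)%N -> 2 * dot W EB <= s * fnorm (W - XB) ^+ 2) ->
    (forall V, (\rank V <= 2 * K)%N -> (1 - delta) * fnorm V ^+ 2 <= fnorm (A V) ^+ 2) ->
  X = XB.
Proof.
move=> gXB gX sX rX rXB XBEB sd hB hA; set D := X - XB.
have AD : fnorm (A D) ^+ 2 = dot D EB - dot D E.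
  rewrite gXB gX fnorm_sqr -dotNr -dotDr; congr (dot _ _).
  by rewrite /D linearB /= opprB [RHS]addrC subrKA.
have := hB X rX; have := sX XB rXB; rewrite fnormB -/D.
have -> : XB - X = - D by rewrite opprB.
rewrite dotNl => h1 h2.
have rD : (\rank D <= 2 * K)%N.
  by rewrite mul2n -addnn (leq_trans (mxrank_add _ _))// mxrank_opp leq_add.
have := hA D rD; rewrite AD [dot D EB]dotDl dotNl XBEB => h3.
apply/eqP; rewrite -subr_eq0 -/D; apply/eqP/fnorm_eq0/eqP; apply: contraT => D0.
have D2 : 0 < fnorm D ^+ 2 by rewrite exprn_gt0// lt_def D0 fnorm_ge0.
nra.
Qed.

End StationaryPoints.

(** * The Eckart-Young inequality over either scalar field *)

Section ComplexifiedStationarity.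
Variables (k : field_kind) (R : realType).
Local Notation F := (base_field k R).
Local Open Scope sesquilinear_scope.

Definition adjmx p q (X : 'M[F]_(p, q)) : 'M[F]_(q, p) := map_mx (@conjF k R) X^T.

Lemma complexify_adjmx p q (X : 'M[F]_(p, q)) :
  complexify (adjmx X) = (complexify X : 'M[R[i]%C]_(p, q))^t*.
Proof. by apply/matrixP => i j; rewrite !mxE to_complex_conj. Qed.

(** Complexification preserves ranks, norms and [dot]. Testing with Z = X^* E and Z = E X^* turns
    the two weak orthogonality relations into matrix equations. *)
Lemma low_rank_dot_le_complexify p q (X E W : 'M[F]_(p, q)) :
    (forall Z, dot (X *m Z) E = 0) -> (forall Z, dot (Z *m X) E = 0) ->
    (forall V : 'M[R[i]%C]_(p, q), (\rank V < \rank X)%N ->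
      fnorm E <= fnorm (k := ComplexScalars) (complexify X - V)) ->
    (\rank W <= \rank X)%N ->
  2 * dot W E <= fnorm (W - X) ^+ 2.
Proof.
move=> XE EX dist rW.
pose Xc : 'M[R[i]%C]_(p, q) := complexify X.
pose Ec : 'M[R[i]%C]_(p, q) := complexify E.
rewrite -dot_complexify -fnorm_complexify complexifyB.
apply: (@low_rank_dot_le R p q Xc Ec (complexify W)).
- by move=> V; rewrite rank_complexify fnorm_complexify; exact: dist.
- have := XE (adjmx X *m E); rewrite -dot_complexify !complexifyM complexify_adjmx.
  by rewrite (@cdotMl R _ _ _ Xc) => /dot_eq0.
- have := EX (E *m adjmx X); rewrite -dot_complexify !complexifyM complexify_adjmx.
  by rewrite (@cdotMr R _ _ _ _ Xc) => /dot_eq0.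
- by rewrite !rank_complexify.
Qed.

End ComplexifiedStationarity.

(** * Consequences of the operator norm bound and of the restricted isometry constant *)

Section OperatorConstants.
Variables (k : field_kind) (R : realType) (n1 n2 m : nat).
Local Notation F := (base_field k R).
Local Notation M := 'M[F]_(n1, n2).
Variable A : {linear M -> 'cV[F]_m}.

Lemma opnorm_lt1_contractive (X : M) :
  (opnorm A < 1%:E)%E -> X != 0 -> fnorm (A X) < fnorm X.
Proof.
move=> hA X0; have Xpos : 0 < fnorm X.
  by rewrite lt_def fnorm_ge0 andbT; apply: contra_neq X0; exact: fnorm_eq0.
pose Y := emb k (fnorm X)^-1 *: X.
have Y1 : fnorm Y <= 1.
  by rewrite fnormZ ger0_norm ?invr_ge0 ?fnorm_ge0// mulVf ?gt_eqF.
have : ((fnorm (A Y))%:E < 1%:E)%E.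
  by apply: le_lt_trans hA; apply: ereal_sup_ubound; exists Y.
rewrite lte_fin /Y linearZ fnormZ ger0_norm ?invr_ge0 ?fnorm_ge0//.
by rewrite mulrC ltr_pdivrMr// mul1r.
Qed.

Lemma delta_lowerP J (X : M) : (\rank X <= J)%N ->
  (1 - delta_lower A J) * fnorm X ^+ 2 <= fnorm (A X) ^+ 2.
Proof.
move=> rX; have [->|X0] := eqVneq X 0.
  by rewrite linear0 !fnorm0 expr0n mulr0.
have Xpos : 0 < fnorm X ^+ 2.
  rewrite exprn_gt0// lt_def fnorm_ge0 andbT; apply: contra_neq X0.
  exact: fnorm_eq0.
rewrite /delta_lower subKr -ler_pdivlMr//; apply: ge_inf; last by exists X.
by exists 0 => _ [Y _ <-]; rewrite divr_ge0 ?sqr_ge0.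
Qed.

Lemma delta_lower_ge0 J (X : M) : (opnorm A < 1%:E)%E -> X != 0 ->
  (\rank X <= J)%N -> 0 <= delta_lower A J.
Proof.
move=> hA X0 /delta_lowerP; have lt := opnorm_lt1_contractive hA X0.
have Xpos : 0 < fnorm X by exact: le_lt_trans (fnorm_ge0 _) lt.
move=> /le_trans/(_ (_ : _ <= fnorm X ^+ 2)).
rewrite ler_pXn2r ?nnegrE ?fnorm_ge0// ltW// => /(_ isT).
by rewrite ger_pMl ?exprn_gt0//; lra.
Qed.

Lemma sqrt_delta_lowerP J (X : M) : (\rank X <= J)%N ->
  Num.sqrt (1 - delta_lower A J) * fnorm X <= fnorm (A X).
Proof.
move=> /delta_lowerP h; have [d0|d0] := leP 0 (1 - delta_lower A J).
  rewrite -(ler_pXn2r (n := 2)) ?nnegrE ?mulr_ge0 ?sqrtr_ge0 ?fnorm_ge0//.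
  by rewrite exprMn sqr_sqrtr.
by rewrite ltr0_sqrtr// mul0r fnorm_ge0.
Qed.

(** The restricted isometry bound gives coercivity: if X does at least as well as 0, then sqrt(1 -
    delta) |X| <= |A X| <= 2 |b|. *)
Lemma low_rank_least_squares J K (b : 'cV[F]_m) : (K <= J)%N ->
    (opnorm A < 1%:E)%E -> delta_lower A J < 1 ->
  exists2 X, (\rank X <= K)%N &
    forall Y, (\rank Y <= K)%N -> fnorm (A X - b) <= fnorm (A Y - b).
Proof.
move=> KJ hA hd; have g0 : 0 < Num.sqrt (1 - delta_lower A J).
  by rewrite sqrtr_gt0 subr_gt0.
apply: (@low_rank_min k R n1 n2 K (fun X => fnorm (A X - b)) 1
  (2 * fnorm b / Num.sqrt (1 - delta_lower A J))) => [X Y|X rX].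
  rewrite mul1r (le_trans (dist_fnorm_le _ _ _))// -linearB.
  exact: contractive_le (fun Z => opnorm_lt1_contractive hA) _.
rewrite linear0 sub0r fnormN ler_pdivlMr// mulrC => h.
apply: le_trans (sqrt_delta_lowerP (leq_trans rX KJ)) _.
by have := fnormD (A X - b) b; rewrite subrK; lra.
Qed.

(** |E|^2 = <A E, b - A X> <= |E| |b - A X|, since A is a contraction. *)
Lemma fnorm_residual_gradient_le (b : 'cV[F]_m) (X E : M) :
  (opnorm A < 1%:E)%E -> residual_gradient A b X E -> fnorm E <= fnorm (A X - b).
Proof.
move=> hA XE; have [E0|E0] := eqVneq (fnorm E) 0; first by rewrite E0 fnorm_ge0.
have Epos : 0 < fnorm E by rewrite lt_def E0 fnorm_ge0.
rewrite -(ler_pM2l Epos) -expr2 fnorm_sqr XE (le_trans (dot_le_fnorm _ _))//.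
rewrite (fnormB b) ler_wpM2r ?fnorm_ge0//.
exact: contractive_le (fun Z => opnorm_lt1_contractive hA) _.
Qed.

Lemma sigma_perturbed K (X0 X : M) (V : 'M[R[i]%C]_(n1, n2)) : (\rank V < K)%N ->
  sigma K X0 - fnorm (X - X0) <= fnorm (k := ComplexScalars) (complexify X - V).
Proof.
move=> /(sigma_le_dist X0); rewrite lerBlDl => /le_trans; apply.
rewrite (fnormB X) -(fnorm_complexify (X0 - X)) complexifyB.
exact: (@fnorm_triangle ComplexScalars).
Qed.

End OperatorConstants.

Theorem theorem6p4 (k : field_kind) (R : realType) (n1 n2 m K : nat)
    (A : {linear 'M[base_field k R]_(n1, n2) -> 'cV[base_field k R]_m})
    (X0 : 'M[base_field k R]_(n1, n2)) (b eps : 'cV[base_field k R]_m)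
    (hA : (opnorm A < 1%:E)%E)
    (hK : (1 <= K)%N)
    (hdelta : delta_lower A (2 * K) < 1 / 2)
    (hb : b = A X0 + eps)
    (hX0 : \rank X0 = K)
    (hsigma : sigma K X0 >
      5 / ((1 - 2 * delta_lower A (2 * K)) `^ (3 / 2)) * fnorm eps) :
  exists XB : 'M[base_field k R]_(n1, n2),
    [/\ argmin (@rank_le k R n1 n2 K) (fun X => fnorm (A X - b)) = [set XB],
        argmin [set: 'M[base_field k R]_(n1, n2)] (Rreg A b K) = [set XB],
        local_minimizers (Rreg A b K) `<=` [set XB]
      & fnorm (XB - X0) <= 2 * fnorm eps / Num.sqrt (1 - delta_lower A (2 * K))].
Proof.
set d := delta_lower A (2 * K) in hdelta hsigma *.
set e := fnorm eps in hsigma *.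
have contr X : X != 0 -> fnorm (A X) < fnorm X by exact: opnorm_lt1_contractive.
have K2 : (K <= 2 * K)%N by rewrite mul2n -addnn leq_addr.
have X0n0 : X0 != 0.
  by apply: contraTneq hK => X00; rewrite -hX0 X00 mxrank0.
have d0 : 0 <= d by apply: (delta_lower_ge0 hA X0n0); rewrite hX0.
have d1 : d < 1 by lra.
have e0 : 0 <= e := fnorm_ge0 _.
set s := 1 - 2 * d in hsigma.
have s01 : 0 < s <= 1 by rewrite /s; apply/andP; split; lra.
have [s0 s1] := andP s01.
(* For 0 < s <= 1 the power s^(3/2) is at most s. *)
have sigma_lb : 5 * (e / s) < sigma K X0.
  apply: le_lt_trans hsigma; rewrite [leRHS]mulrAC -[leRHS]mulrA.
  rewrite ler_wpM2l// ler_wpM2l// lef_pV2 ?posrE ?powR_gt0//.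
  rewrite -[leRHS]powRr1 ?(ltW s0)//; apply: ger_powR => //; lra.
have es : e <= e / s by rewrite ler_pdivlMr// ler_piMr.
set g := Num.sqrt (1 - d).
have g2 : g ^+ 2 = 1 - d by rewrite sqr_sqrtr//; lra.
have g0 : 0 < g by rewrite sqrtr_gt0; lra.
(* From d < 1/2, g^2 > 1/2 and so 3 g >= 2. *)
have eg : 2 * e / g <= 3 * e.
  rewrite ler_pdivrMr//; have : 2 <= 3 * g by nra.
  nra.
have [XB rXB XBmin] := low_rank_least_squares b K2 hA d1.
have rXB_e : fnorm (A XB - b) <= e.
  by rewrite (le_trans (XBmin X0 _)) ?hX0// hb opprD addrA subrr sub0r fnormN.
have XBX0 : fnorm (XB - X0) <= 2 * e / g.
  rewrite ler_pdivlMr// mulrC; apply: le_trans (sqrt_delta_lowerP A _) _.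
    by rewrite mul2n -addnn (leq_trans (mxrank_add _ _))// mxrank_opp hX0 leq_add2r.
  rewrite linearB /= (le_trans (fnorm_triangle b _ _))//.
  have -> : b - A X0 = eps by rewrite hb addrC addKr.
  by rewrite -/e; lra.
have [EB gB] := residual_gradient_exists A b XB.
have sB := low_rank_minimizer_stationary contr gB XBmin.
have EBe : fnorm EB <= e := le_trans (fnorm_residual_gradient_le hA gB) rXB_e.
have [XE EX] := stationary_orthogonal rXB sB.
have XBEB : dot XB EB = 0 by rewrite -[XB]mulmx1 XE.
(* If rank XB < K, then sigma_K(X0) <= |XB - X0| <= 3 e, against [sigma_lb] and [es]. *)
have rXBK : \rank XB = K.
  apply/eqP; rewrite eqn_leq rXB leqNgt; apply/negP => lt.
  have := @sigma_perturbed k R n1 n2 K X0 XB (complexify XB).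
  by rewrite rank_complexify => /(_ lt); rewrite subrr fnorm0; lra.
(* Two demands fix [kappa]: kappa e = (5/4) e / s must not exceed sigma_K(X0) - 3 e, which is more
   than 2 e / s, and 1 / kappa = (4/5) s must be less than s = 1 - 2 d. *)
pose kappa := 5 / (4 * s).
have kappa0 : 0 < kappa by rewrite divr_gt0// mulr_gt0.
have bestB W : (\rank W <= K)%N -> 2 * dot W EB <= 4 / 5 * s * fnorm (W - XB) ^+ 2.
  move=> rW.
  have : 2 * dot W (emb k kappa *: EB) <= fnorm (W - XB) ^+ 2.
    apply: low_rank_dot_le_complexify; rewrite ?rXBK//.
    - by move=> Z; rewrite dotZr XE mulr0.
    - by move=> Z; rewrite dotZr EX mulr0.
    move=> V rV; apply: le_trans (sigma_perturbed X0 XB rV).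
    rewrite fnormZ gtr0_norm//.
    have : kappa * fnorm EB <= 5 / 4 * (e / s).
      have -> : 5 / 4 * (e / s) = kappa * e by rewrite /kappa; field; rewrite gt_eqF.
      by rewrite ler_pM2l.
    lra.
  rewrite dotZr mulrCA -ler_pdivlMl// => /le_trans; apply.
  by rewrite /kappa invf_div le_eqVlt; apply/orP; left; apply/eqP; field.
have uniq X E : residual_gradient A b X E -> stationary K X E ->
    (\rank X <= K)%N -> X = XB.
  move=> gX sX rX.
  have sd : 4 / 5 * s < 1 - 2 * d by rewrite -/s; lra.
  exact: (stationary_unique gB gX sX rX rXB XBEB sd bestB
    (fun V => @delta_lowerP k R n1 n2 m A (2 * K) V)).
have uniq_min X : (\rank X <= K)%N ->
    (forall W, (\rank W <= K)%N -> fnorm (A X - b) <= fnorm (A W - b)) -> X = XB.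
  move=> rX Xmin; have [E gX] := residual_gradient_exists A b X.
  exact: uniq gX (low_rank_minimizer_stationary contr gX Xmin) rX.
exists XB; split => //.
- by apply/seteqP; split=> [X [rX Xmin]|_ ->]; [exact: uniq_min|].
- exact: Rreg_argmin.
- move=> X Xloc; have [E gX] := residual_gradient_exists A b X.
  have [rX sX] := local_minimizer_stationary contr hK gX Xloc.
  exact: uniq gX sX rX.
Qed.
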